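(* For all integers $n,k\geq 1$, we have $Y_{\mathbb{C}}(n,k)=Y_{\mathbb{R}}(n,k)$.
   Context: For $L\in\{\mathbb{R},\mathbb{C}\}$, an $(n+k)$-nomial $n\times n$ system over $L$ is a tuple $F=(f_1,\ldots,f_n)$ of Laurent polynomials $f_i\in L[x_1^{\pm1},\ldots,x_n^{\pm1}]$ such that the total number of distinct exponent vectors in the monomial term expansions of $f_1,\ldots,f_n$ is $n+k$. A root of $F$ is non-degenerate if the Jacobian matrix of $F$ at it has rank $n$. The generalized phase of $y\in L^*$ is $\phi(y):=y/|y|$; so $y$ has generalized phase $1$ if and only if $y$ is a positive real number. $Y_L(n,k)$ is the supremum, over all $(n+k)$-nomial $n\times n$ systems $F$ over $L$, of the number of non-degenerate roots of $F$ in $L^n$ all of whose coordinates have generalized phase $1$ (i.e., of non-degenerate roots in the open positive orthant of $\mathbb{R}^n$). *)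

(* Defs.v *)
From HB Require Import structures.
From mathcomp Require Import all_boot all_order all_algebra.
From mathcomp Require Import finmap.
From mathcomp Require Import all_classical all_reals ereal measure.
From mathcomp Require Import complex.

Set Implicit Arguments.
Unset Strict Implicit.
Unset Printing Implicit Defensive.

Import Order.TTheory GRing.Theory Num.Theory.

Local Open Scope classical_set_scope.
Local Open Scope ring_scope.

(* The ring L[x_1^(+-1), ..., x_n^(+-1)] as finitely supported maps from exponent
   vectors to coefficients: finsupp f is the set of exponent vectors in the
   monomial term expansion of f. *)
Definition laurent (L : numFieldType) (n : nat) : Type :=
  {fsfun 'rV[int]_n -> L with 0}.

Definition lmonomial (L : numFieldType) (n : nat) (a : 'rV[int]_n)
    (x : 'rV[L]_n) : L :=
  \prod_(i < n) x ord0 i ^ a ord0 i.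

Definition leval (L : numFieldType) (n : nat) (f : laurent L n)
    (x : 'rV[L]_n) : L :=
  \sum_(a <- finsupp f) f a * lmonomial a x.

(* Value at x of the formal partial derivative of f with respect to the j-th
   variable, using d/dx_j (c x^a) = c a_j x^(a - e_j). *)
Definition lpderiv (L : numFieldType) (n : nat) (f : laurent L n) (j : 'I_n)
    (x : 'rV[L]_n) : L :=
  \sum_(a <- finsupp f)
    f a * (a ord0 j)%:~R * lmonomial (a - delta_mx ord0 j) x.

Definition system (L : numFieldType) (n : nat) : Type := 'I_n -> laurent L n.

Definition jacobian (L : numFieldType) (n : nat) (F : system L n)
    (x : 'rV[L]_n) : 'M[L]_n :=
  \matrix_(i < n, j < n) lpderiv (F i) j x.

Definition is_nomial_system (L : numFieldType) (n k : nat)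
    (F : system L n) : Prop :=
  #|` (\big[fsetU/fset0]_(i < n) finsupp (F i))%fset | = (n + k)%N.

(* The numFieldType norm is L-valued, so that the quotient lives in L both for
   L = R and for L = R[i]. Since 0 / 0 = 0, phase 0 != 1. *)
Definition phase (L : numFieldType) (y : L) : L := y / `|y|.

Definition nondeg_phase1_roots (L : numFieldType) (n : nat)
    (F : system L n) : set 'rV[L]_n :=
  [set x | [/\ forall i : 'I_n, leval (F i) x = 0,
               \rank (jacobian F x) = n
             & forall i : 'I_n, phase (x ord0 i) = 1]].

(* Y_L(n, k). The supremum is taken in the extended reals over the base field R,
   an infinite set of roots being counted as +oo. *)
Definition Ysup (R : realType) (L : numFieldType) (n k : nat) : \bar R :=
  ereal_sup [set (counting (nondeg_phase1_roots F) : \bar R)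
            | F in [set F : system L n | is_nomial_system k F]].

(* Main.v *)
Require Import Defs.
From HB Require Import structures.
From mathcomp Require Import all_boot all_order all_algebra.
From mathcomp Require Import finmap.
From mathcomp Require Import all_classical all_reals ereal measure.
From mathcomp Require Import complex.

(** A real system is a complex system with the same non-degenerate positive
    roots.  Conversely, let [F] be a complex system and [S] a finite set of
    non-degenerate positive roots of [F].  For a complex matrix [U], the real
    system [Re (U F)] vanishes on [S], and its Jacobian matrix at [x] is
    [Re (U J(x))], which is the identity for [U = J(x)^-1].  Hence
    non-degeneracy of [Re (U F)] at the points of [S], as well as not losing any
    exponent vector of [F], amount to the nonvanishing at [U] of finitely many
    nonzero real polynomials, which have a common nonvanishing point. *)

Set Implicit Arguments.
Unset Strict Implicit.
Unset Printing Implicit Defensive.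

Import Order.TTheory GRing.Theory Num.Theory.

Local Open Scope classical_set_scope.
Local Open Scope ring_scope.

(** A nonzero [p] has fewer than [size p] roots, so one of the [size p] distinct naturals below
    [size p] is not a root. *)
Lemma exists_nonroot (R : numDomainType) (p : {poly R}) :
  p != 0 -> exists t, p.[t] != 0.
Proof.
move=> p0; pose s := [seq i%:R : R | i <- iota 0 (size p)].
have us : uniq s by rewrite map_inj_uniq ?iota_uniq //; exact: mulrIn (oner_neq0 _).
case: (boolP (all (root p) s)) => [rs|/allPn[t _ pt]]; last by exists t.
by have := max_poly_roots p0 rs us; rewrite size_map size_iota ltnn.
Qed.

(** * Real linearity of the real part *)

Section ComplexParts.
Variable R : rcfType.
Implicit Types (x y : R[i]) (t : R).

Lemma ReD x y : complex.Re (x + y) = complex.Re x + complex.Re y.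
Proof. by case: x; case: y. Qed.

Lemma Re_sum (I : Type) (r : seq I) (P : pred I) (f : I -> R[i]) :
  complex.Re (\sum_(i <- r | P i) f i) = \sum_(i <- r | P i) complex.Re (f i).
Proof. exact: (big_morph _ ReD). Qed.

Lemma Re_mulRl t x : complex.Re (t%:C%C * x) = t * complex.Re x.
Proof. by case: x => a b /=; rewrite mul0r subr0. Qed.

Lemma Re_mulRr t x : complex.Re (x * t%:C%C) = complex.Re x * t.
Proof. by rewrite mulrC Re_mulRl mulrC. Qed.

End ComplexParts.

(** * Functions that are polynomial along real lines *)

Section PolynomialOnLines.
Variables (R : rcfType) (V : lmodType R[i]).

(** A substitute for real polynomials in the real and imaginary parts of the coordinates: univariate
    restrictions suffice below. The parameter [t] is real because the real part is only
    real-linear. *)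
Definition poly_on_real_lines (f : V -> R) : Prop :=
  forall u v, exists p : {poly R}, forall t, f (u + t%:C%C *: v) = p.[t].

Lemma poly_on_real_linesM (f g : V -> R) :
  poly_on_real_lines f -> poly_on_real_lines g ->
  poly_on_real_lines (fun u => f u * g u).
Proof.
move=> hf hg u v; have [p hp] := hf u v; have [q hq] := hg u v.
by exists (p * q) => t; rewrite hp hq hornerM.
Qed.

Lemma poly_on_real_lines_prod (I : eqType) (s : seq I) (f : I -> V -> R) :
  (forall i, i \in s -> poly_on_real_lines (f i)) ->
  poly_on_real_lines (fun u => \prod_(i <- s) f i u).
Proof.
elim: s => [|i s IHs] hf u v.
  by exists 1 => t; rewrite big_nil hornerC.
have hfs j : j \in s -> poly_on_real_lines (f j).
  by move=> js; apply: hf; rewrite in_cons js orbT.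
have [p hp] := poly_on_real_linesM (hf i (mem_head _ _)) (IHs hfs) u v.
by exists p => t; rewrite -hp big_cons.
Qed.

(** On the line through [u] and [v], the restriction of [f] is nonzero at [t = 0] and that of [g] at
    [t = 1]. Both are thus nonzero polynomials, and so is their product. *)
Lemma poly_on_real_lines_neq0M (f g : V -> R) (u v : V) :
  poly_on_real_lines f -> poly_on_real_lines g ->
  f u != 0 -> g v != 0 -> exists w, f w * g w != 0.
Proof.
move=> hf hg fu gv.
have [p hp] := hf u (v - u); have [q hq] := hg u (v - u).
have p0 : p != 0.
  by apply: contraNneq fu => p0; have := hp 0; rewrite scale0r addr0 p0 horner0 => ->.
have q0 : q != 0.
  apply: contraNneq gv => q0; have := hq 1.
  by rewrite scale1r addrC subrK q0 horner0 => ->.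
have [t ht] := exists_nonroot (mulf_neq0 p0 q0).
by exists (u + t%:C%C *: (v - u)); rewrite hp hq -hornerM.
Qed.

Lemma poly_on_real_lines_common_neq0 (I : eqType) (s : seq I)
    (f : I -> V -> R) :
  (forall i, i \in s -> poly_on_real_lines (f i)) ->
  (forall i, i \in s -> exists u, f i u != 0) ->
  exists u, forall i, i \in s -> f i u != 0.
Proof.
move=> hf h0.
suff [u hu] : exists u, \prod_(i <- s) f i u != 0.
  by exists u => i si; rewrite prodf_seq_neq0 in hu; exact: (allP hu).
elim: s hf h0 => [|i s IHs] hf h0.
  by exists 0; rewrite big_nil oner_neq0.
have hfs j : j \in s -> poly_on_real_lines (f j).
  by move=> js; apply: hf; rewrite in_cons js orbT.
have [u fu] := h0 i (mem_head _ _).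
have [|v gv] := IHs hfs.
  by move=> j js; apply: h0; rewrite in_cons js orbT.
have [w hw] := poly_on_real_lines_neq0M (hf i (mem_head _ _))
  (poly_on_real_lines_prod hfs) fu gv.
by exists w; rewrite big_cons.
Qed.

End PolynomialOnLines.

Lemma poly_on_real_lines_Re_mulmx (R : rcfType) (m n p : nat)
    (b : 'M[R[i]]_(n, p)) (i : 'I_m) (j : 'I_p) :
  poly_on_real_lines (fun U : 'M[R[i]]_(m, n) => complex.Re ((U *m b) i j)).
Proof.
move=> U V.
exists ((complex.Re ((U *m b) i j))%:P + (complex.Re ((V *m b) i j))%:P * 'X) => t.
by rewrite mulmxDl -scalemxAl !mxE ReD Re_mulRl !hornerE mulrC.
Qed.

Lemma poly_on_real_lines_det_Re_mulmx (R : rcfType) (n : nat) (J : 'M[R[i]]_n) :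
  poly_on_real_lines
    (fun U : 'M[R[i]]_n => \det (map_mx (@complex.Re R) (U *m J))).
Proof.
move=> U V; pose re (A : 'M_n) := map_mx (@complex.Re R) (A *m J).
(* The determinant commutes with the ring morphism evaluating ['X] at [t]. *)
exists (\det (map_mx polyC (re U) + 'X *: map_mx polyC (re V))) => t.
rewrite -[RHS]/(horner_eval t _) -det_map_mx; congr (\det _).
apply/matrixP => i j.
by rewrite mulmxDl -scalemxAl !mxE ReD Re_mulRl /= /horner_eval !hornerE.
Qed.

(** * Laurent polynomials over a common support, and positivity *)

Section LaurentSums.
Variables (L : numFieldType) (n : nat).
Implicit Types (f : laurent L n) (D : {fset 'rV[int]_n}) (x : 'rV[L]_n).

(** Coefficients outside the support are 0. Summing all components of a system over one set [D]
    later allows exchanging sums. *)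
Lemma leval_sub f D x : (finsupp f `<=` D)%fset ->
  leval f x = \sum_(a <- D) f a * lmonomial a x.
Proof.
move=> fD; apply: big_fset_incl => // a _ fa.
by rewrite fsfun_dflt // mul0r.
Qed.

Lemma lpderiv_sub f D j x : (finsupp f `<=` D)%fset ->
  lpderiv f j x =
  \sum_(a <- D) f a * ((a ord0 j)%:~R * lmonomial (a - delta_mx ord0 j) x).
Proof.
move=> fD; rewrite /lpderiv; under eq_bigr do rewrite -mulrA.
apply: big_fset_incl => // a _ fa.
by rewrite fsfun_dflt // mul0r.
Qed.

(** Phase 1 forces [y] to equal its norm. Over [R[i]], [0 < y] includes that [y] is real. *)
Lemma phase_eq1 (y : L) : (phase y = 1) <-> (0 < y).
Proof.
rewrite /phase; split=> [h|y0]; last by rewrite gtr0_norm // divff ?gt_eqF.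
have y0 : y != 0.
  by apply/eqP => y0; move: h; rewrite y0 mul0r => /esym/eqP; rewrite oner_eq0.
have /divr1_eq -> := h.
by rewrite normr_gt0.
Qed.

Lemma rank_eq_det_neq0 (A : 'M[L]_n) : (\rank A = n) <-> (\det A != 0).
Proof.
rewrite -unitfE -[\det A \is a _]/(A \in unitmx) -row_free_unit /row_free.
by split=> /eqP.
Qed.

End LaurentSums.

Lemma lmonomial_map (K L : numFieldType) (phi : {rmorphism K -> L}) (n : nat)
    (a : 'rV[int]_n) (x : 'rV[K]_n) :
  lmonomial a (map_mx phi x) = phi (lmonomial a x).
Proof.
rewrite /lmonomial rmorph_prod; apply: eq_bigr => i _.
by rewrite mxE fmorphXz.
Qed.

(** * Comparing suprema of root counts through finite sets of roots *)

Section Counting.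
Variable R : realType.
Local Open Scope ereal_scope.

Lemma le_counting (T : choiceType) (A : set T) (s : seq T) :
  uniq s -> {subset s <= A} -> (size s)%:R%:E <= (counting A : \bar R).
Proof.
move=> us sA; rewrite /counting; case: asboolP => [fA|_]; last by rewrite leey.
rewrite lee_fin ler_nat; apply: uniq_leq_size us _ => x /sA xA.
by rewrite in_fset_set.
Qed.

(** An infinite [A] has finite subsets of every size, so [M] exceeds every real number. *)
Lemma counting_le (T : choiceType) (A : set T) (M : \bar R) :
  (forall s : seq T, uniq s -> {subset s <= A} -> (size s)%:R%:E <= M) ->
  counting A <= M.
Proof.
move=> h; rewrite /counting; case: asboolP => [fA|/infinite_set_fset infA].
  by apply: h => [|x]; rewrite ?fset_uniq // in_fset_set.
suff -> : M = +oo by [].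
apply/eqyP => r r0.
have [B BA] := infA (Num.truncn r).+1.
rewrite -(ler_nat R) => rB.
apply: (@le_trans _ _ (#|` B|)%:R%:E).
  by rewrite lee_fin (le_trans _ rB) // ltW // truncnS_gt.
by apply: h => [|x xB]; rewrite ?fset_uniq // inE; exact: BA.
Qed.

(** The system [G] may depend on the finite list [s]: bounding the size of each finite set of roots
    bounds the count, even an infinite one. *)
Lemma Ysup_le (K L : numFieldType) (n k : nat) (phi : 'rV[K]_n -> 'rV[L]_n) :
  (forall F : system K n, is_nomial_system k F ->
    {in nondeg_phase1_roots F &, injective phi} /\
    forall s : seq 'rV[K]_n, {subset s <= nondeg_phase1_roots F} ->
    exists2 G : system L n, is_nomial_system k G &
      forall x, x \in s -> nondeg_phase1_roots G (phi x)) ->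
  Ysup R K n k <= Ysup R L n k.
Proof.
move=> h; apply: ge_ereal_sup => _ [F Fk <-].
have [phiI hG] := h F Fk.
apply: counting_le => s us sF; have [G Gk sG] := hG s sF.
apply: (@le_trans _ _ (counting (nondeg_phase1_roots G))); last first.
  by apply: ereal_sup_ubound; exists G.
rewrite -(size_map phi); apply: le_counting.
  by rewrite map_inj_in_uniq // => x y /sF xF /sF yF; exact: phiI.
by move=> _ /mapP[x xs ->]; rewrite inE; exact: sG.
Qed.

End Counting.

(** * From real systems to complex systems *)

Section Complexification.
Variables (R : rcfType) (n : nat).

Definition complexify (F : system R n) : system R[i] n := fun i =>
  [fsfun a in finsupp (F i) => (F i a)%:C%C].

Lemma complexifyE F i a : complexify F i a = (F i a)%:C%C.
Proof. by rewrite fsfunE; case: finsuppP. Qed.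

Lemma finsupp_complexify F i : finsupp (complexify F i) = finsupp (F i).
Proof.
by apply/fsetP => a; rewrite !mem_finsupp complexifyE fmorph_eq0.
Qed.

Lemma leval_complexify F i (x : 'rV[R]_n) :
  leval (complexify F i) (map_mx (real_complex R) x) = (leval (F i) x)%:C%C.
Proof.
rewrite /leval finsupp_complexify rmorph_sum; apply: eq_bigr => a _.
by rewrite complexifyE lmonomial_map rmorphM.
Qed.

Lemma jacobian_complexify F (x : 'rV[R]_n) :
  jacobian (complexify F) (map_mx (real_complex R) x) =
  map_mx (real_complex R) (jacobian F x).
Proof.
apply/matrixP => i j.
rewrite !mxE /lpderiv finsupp_complexify rmorph_sum; apply: eq_bigr => a _.
by rewrite complexifyE lmonomial_map !rmorphM rmorph_int.
Qed.

Lemma nondeg_phase1_roots_complexify F x :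
  nondeg_phase1_roots F x ->
  nondeg_phase1_roots (complexify F) (map_mx (real_complex R) x).
Proof.
move=> [Fx Jx px]; split=> [i||i].
- by rewrite leval_complexify Fx.
- by rewrite jacobian_complexify mxrank_map.
- by apply/phase_eq1; rewrite mxE ltcR; exact/phase_eq1.
Qed.

Lemma is_nomial_system_complexify k F :
  is_nomial_system k F -> is_nomial_system k (complexify F).
Proof.
rewrite /is_nomial_system.
by under [in X in _ -> X]eq_bigr do rewrite finsupp_complexify.
Qed.

End Complexification.

(** * From complex systems to real systems *)

Section RealPart.
Variables (R : rcfType) (n : nat) (F : system R[i] n).

Let D := (\big[fsetU/fset0]_(i < n) finsupp (F i))%fset.

Lemma finsupp_sub_system i : (finsupp (F i) `<=` D)%fset.
Proof. exact: (bigfcup_sup _ (mem_index_enum i)). Qed.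

(** The system [Re (U F)]. Its support may be smaller than [D], since a coefficient of [U F] can
    have real part 0. *)
Definition real_part_system (U : 'M[R[i]]_n) : system R n := fun i =>
  [fsfun a in D => complex.Re (\sum_j U i j * F j a)].

Lemma real_part_systemE U i a :
  real_part_system U i a = complex.Re (\sum_j U i j * F j a).
Proof.
rewrite fsfunE; case: ifPn => // aD.
rewrite big1 // => j _; rewrite fsfun_dflt ?mulr0 //.
by apply: contraNN aD; apply/fsubsetP/finsupp_sub_system.
Qed.

Lemma finsupp_real_part_system U i : (finsupp (real_part_system U i) `<=` D)%fset.
Proof. exact: finsupp_sub. Qed.

(** Real weights pass through the real part. The weights are monomials for values, and
    differentiated monomials for the Jacobian matrix. *)
Lemma sum_real_part_system U i (w : 'rV[int]_n -> R) :
  \sum_(a <- D) real_part_system U i a * w a =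
  complex.Re (\sum_j U i j * \sum_(a <- D) F j a * (w a)%:C%C).
Proof.
under [in RHS]eq_bigr do rewrite mulr_sumr.
rewrite exchange_big Re_sum; apply: eq_bigr => a _ /=.
rewrite real_part_systemE -Re_mulRr mulr_suml; congr complex.Re.
by apply: eq_bigr => j _; rewrite mulrA.
Qed.

Lemma leval_real_part_system U i x :
  leval (real_part_system U i) x =
  complex.Re (\sum_j U i j * leval (F j) (map_mx (real_complex R) x)).
Proof.
rewrite (leval_sub _ (finsupp_real_part_system U i)) sum_real_part_system.
congr complex.Re; apply: eq_bigr => j _; congr (_ * _).
rewrite (leval_sub _ (finsupp_sub_system j)); apply: eq_bigr => a _.
by rewrite lmonomial_map.
Qed.

Lemma jacobian_real_part_system U x :
  jacobian (real_part_system U) x =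
  map_mx (@complex.Re R) (U *m jacobian F (map_mx (real_complex R) x)).
Proof.
apply/matrixP => i j; rewrite !mxE.
rewrite (lpderiv_sub _ _ (finsupp_real_part_system U i)) sum_real_part_system.
congr complex.Re; apply: eq_bigr => l _; congr (_ * _).
rewrite mxE (lpderiv_sub _ _ (finsupp_sub_system l)); apply: eq_bigr => a _.
by rewrite lmonomial_map rmorphM rmorph_int.
Qed.

Lemma phase1_real (x : 'rV[R[i]]_n) :
  (forall i, phase (x ord0 i) = 1) ->
  map_mx (real_complex R) (map_mx (@complex.Re R) x) = x.
Proof.
move=> px; apply/rowP => i; rewrite !mxE RRe_real //.
by apply: gtr0_real; exact/phase_eq1.
Qed.

Lemma nondeg_phase1_roots_real_part_system U x :
  nondeg_phase1_roots F x ->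
  \det (map_mx (@complex.Re R) (U *m jacobian F x)) != 0 ->
  nondeg_phase1_roots (real_part_system U) (map_mx (@complex.Re R) x).
Proof.
move=> [Fx _ px] dx; split=> [i||i].
- rewrite leval_real_part_system phase1_real // big1 // => j _.
  by rewrite Fx mulr0.
- by rewrite jacobian_real_part_system phase1_real //; exact/rank_eq_det_neq0.
- have /phase_eq1 x0 := px i.
  by apply/phase_eq1; rewrite mxE -ltcR RRe_real ?gtr0_real.
Qed.

(** Every exponent vector in [D] comes from some [F i] and survives in row [i], so the union of the
    supports is again [D]. *)
Lemma is_nomial_real_part_system k U :
  is_nomial_system k F ->
  (forall i a, a \in finsupp (F i) -> real_part_system U i a != 0) ->
  is_nomial_system k (real_part_system U).
Proof.
move=> Fk hU.
suff /eqP e :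
    (\big[fsetU/fset0]_(i < n) finsupp (real_part_system U i) == D)%fset.
  by rewrite /is_nomial_system e.
rewrite eqEfsubset; apply/andP; split; apply/bigfcupsP => i _ _.
  exact: finsupp_real_part_system.
apply: fsubset_trans (bigfcup_sup _ (mem_index_enum i) isT).
by apply/fsubsetP => a /hU; rewrite mem_finsupp.
Qed.

Lemma exists_real_part_system k (s : seq 'rV[R[i]]_n) :
  is_nomial_system k F -> {subset s <= nondeg_phase1_roots F} ->
  exists2 U, is_nomial_system k (real_part_system U) &
    forall x, x \in s ->
      nondeg_phase1_roots (real_part_system U) (map_mx (@complex.Re R) x).
Proof.
move=> Fk sF.
(* [inl x] encodes non-degeneracy at [x], and [inr (i, a)] the survival of [a] in row [i]. All
   columns of the last matrix are the vector of coefficients at [a], so the diagonal entry is the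
   coefficient of row [i] of [U F] at [a]. *)
pose f (c : 'rV[R[i]]_n + 'I_n * 'rV[int]_n) (U : 'M[R[i]]_n) : R :=
  match c with
  | inl x => \det (map_mx (@complex.Re R) (U *m jacobian F x))
  | inr (i, a) => complex.Re ((U *m \matrix_(j, l < n) F j a) i i)
  end.
pose t := [seq (i, a) | i <- enum 'I_n, a <- finsupp (F i)].
have [||U hU] := @poly_on_real_lines_common_neq0 R _ _
  ([seq inl x | x <- s] ++ [seq inr c | c <- t]) f.
- move=> [x|[i a]] _; first exact: poly_on_real_lines_det_Re_mulmx.
  exact: poly_on_real_lines_Re_mulmx.
- move=> c; rewrite mem_cat => /orP[/mapP[x xs ->]|/mapP[[i a] + ->]] /=.
    have := sF x xs; rewrite inE => -[_ /rank_eq_det_neq0 Jx _].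
    exists (invmx (jacobian F x)); rewrite mulVmx ?unitmxE ?unitfE //.
    have -> : map_mx (@complex.Re R) 1%:M = 1%:M :> 'M_n.
      by apply/matrixP => j l; rewrite !mxE; case: eqP.
    by rewrite det1 oner_neq0.
  move=> /allpairsPdep[j [b [_ + [-> ->]]]]; rewrite mem_finsupp => Fb.
  (* This scalar matrix makes the coefficient at [b] in row [j] equal to 1. *)
  by exists ((F j b)^-1%:M); rewrite mul_scalar_mx !mxE mulVf //= oner_neq0.
exists U.
  apply: is_nomial_real_part_system => // i a ia.
  have := hU (inr (i, a)); rewrite mem_cat orbC map_f ?orTb /=; last first.
    by apply/allpairsPdep; exists i, a; rewrite mem_enum.
  move=> /(_ isT); rewrite real_part_systemE mxE.
  by under eq_bigr do rewrite mxE.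
move=> x xs; apply: nondeg_phase1_roots_real_part_system.
  by have := sF x xs; rewrite inE.
by apply: (hU (inl x)); rewrite mem_cat map_f.
Qed.

End RealPart.

Theorem theorem1p10 (R : realType) (n k : nat) (hn : (1 <= n)%N)
  (hk : (1 <= k)%N) :
  Ysup R R[i] n k = Ysup R R n k.
Proof.
apply/le_anti/andP; split.
  (* Roots of phase 1 have real coordinates, so taking real parts is injective on them. *)
  apply: (@Ysup_le R _ _ n k (map_mx (@complex.Re R))) => F Fk; split.
    move=> x y; rewrite !inE => -[_ _ px] [_ _ py] xy.
    by rewrite -(phase1_real px) xy phase1_real.
  move=> s sF; have [U Uk Us] := exists_real_part_system Fk sF.
  by exists (real_part_system F U).
(* Conversely, [complexify F] serves for every list [s] at once. *)
apply: (@Ysup_le R _ _ n k (map_mx (real_complex R))) => F Fk; split.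
  by move=> x y _ _ /map_mx_inj; apply; exact: fmorph_inj.
move=> s sF; exists (complexify F); first exact: is_nomial_system_complexify.
by move=> x /sF; rewrite inE; exact: nondeg_phase1_roots_complexify.
Qed.
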